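(* Let $\mathcal{RW}^m_1=(J\times N^{m-1}(c),g_f)$ be a Robertson-Walker space-time. Let $\alpha(s)$, $s\in I$, be a geodesic, parametrized by arc length, in $N^{m-1}(c)$, and consider the curve $\gamma(s)=(t_0,\alpha(d\,s))$ in $\mathcal{RW}^m_1$ (defined for $d\,s\in I$), where $t_0$ is any fixed real value in the interval $J$ and $d=1/f(t_0)$. Let $r\ge2$. Then $\gamma$ is a proper $r$-harmonic curve in $\mathcal{RW}^m_1$ if and only if $$f'(t_0)\ne0\qquad\text{and}\qquad f'(t_0)^2+(r-1)f(t_0)f''(t_0)=0.$$
   Context: A Robertson-Walker space-time is $\mathcal{RW}^m_1=(J\times N^{m-1}(c),g_f)$, where $J$ is a real open interval, $(N^{m-1}(c),g)$ is a Riemannian $(m-1)$-dimensional space form of constant sectional curvature $c$, $f$ is a smooth positive function on $J$, and $g_f=-dt^2+f^2(t)\,g$ (a Lorentzian metric). For a semi-Riemannian manifold with Levi-Civita connection $\nabla$, $R(X,Y)Z=\nabla_X\nabla_YZ-\nabla_Y\nabla_XZ-\nabla_{[X,Y]}Z$. For a nonnull smooth curve $\gamma$ parametrized by arc length, $T=\gamma'$, $\nabla_T^0T=T$, $\nabla_T^jT=\nabla_T(\nabla_T^{j-1}T)$; for $r\ge2$, $\gamma$ is $r$-harmonic if $$\tau_r(\gamma)=\nabla^{2r-1}_T T+\sum_{\ell=0}^{r-2}(-1)^\ell R\big(\nabla^{2r-3-\ell}_T T,\nabla^{\ell}_T T\big)T=0,$$ and proper $r$-harmonic if it is $r$-harmonic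 and not a geodesic. *)

(* Defs.v *)
From HB Require Import structures.
From mathcomp Require Import all_boot all_order all_algebra.
From mathcomp Require Import ring.
From mathcomp Require Import all_classical all_reals all_analysis.
Set Implicit Arguments.
Unset Strict Implicit.
Unset Printing Implicit Defensive.
Import Order.TTheory GRing.Theory Num.Theory numFieldNormedType.Exports.
Local Open Scope ring_scope.
Local Open Scope classical_set_scope.

(* The libraries used here have no differential geometry, so
   manifolds are given by atlases and every tensorial notion is computed in the
   charts of the atlas; a pointwise condition is required in every chart of the
   atlas around the point (it does not depend on the chart). *)

Definition open_interval (R : realType) (J : set R) : Prop :=
  [/\ open J, is_interval J & J !=set0].

Definition e_ (R : realType) (n : nat) (i : 'I_n) : 'rV[R]_n := delta_mx 0 i.

(* [U] is meant to be open *)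
Fixpoint Ck_on (R : realType) (n : nat) (W : normedModType R) (k : nat)
    (U : set 'rV[R]_n) (F : 'rV[R]_n -> W) : Prop :=
  (forall x, U x -> {for x, continuous F}) /\
  if k is k'.+1 then
    forall i : 'I_n, (forall x, U x -> derivable F x (e_ R i)) /\
                     Ck_on k' U (fun x => 'D_(e_ R i) F x)
  else True.

Definition smooth_on (R : realType) (n : nat) (W : normedModType R)
    (U : set 'rV[R]_n) (F : 'rV[R]_n -> W) : Prop :=
  forall k, Ck_on k U F.

(* [U] is meant to be open; derivability of all orders implies continuity *)
Definition smooth1_on (R : realType) (W : normedModType R)
    (U : set R) (F : R -> W) : Prop :=
  forall k t, U t -> derivable (derive1n k F) t 1.

Section LocalGeometry.
Variables (R : realType) (n : nat).
Local Notation pt := 'rV[R]_n.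
Local Notation vfield := (pt -> 'rV[R]_n).
Variable g : pt -> 'M[R]_n.

Definition inner (x : pt) (u v : 'rV[R]_n) : R := (u *m g x *m v^T) 0 0.

Definition dg (k i j : 'I_n) (x : pt) : R := 'D_(e_ R k) (fun y => g y i j) x.

(* Gamma^k_ij, the connection coefficients of the Levi-Civita connection
   (see [christoffelC] and [christoffel_metric]) *)
Definition christoffel (x : pt) (k i j : 'I_n) : R :=
  2^-1 * \sum_(l < n)
    invmx (g x) k l * (dg i j l x + dg j i l x - dg l i j x).

Definition christoffel_term (x : pt) (u v : 'rV[R]_n) : 'rV[R]_n :=
  \row_k \sum_(i < n) \sum_(j < n) christoffel x k i j * u 0 i * v 0 j.

Definition nabla (X Y : vfield) : vfield :=
  fun x => 'D_(X x) Y x + christoffel_term x (X x) (Y x).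

Definition lie_bracket (X Y : vfield) : vfield :=
  fun x => 'D_(X x) Y x - 'D_(Y x) X x.

Definition riemann (X Y Z : vfield) : vfield := fun x =>
  nabla X (nabla Y Z) x - nabla Y (nabla X Z) x - nabla (lie_bracket X Y) Z x.

(* R(u,v)w for tangent vectors at x: [riemann] is tensorial, so u, v, w may be
   extended by the fields with constant components in the chart *)
Definition curvature (x : pt) (u v w : 'rV[R]_n) : 'rV[R]_n :=
  riemann (cst u) (cst v) (cst w) x.

Definition sectional_curvature (x : pt) (u v : 'rV[R]_n) : R :=
  inner x (curvature x u v v) u /
  (inner x u u * inner x v v - inner x u v ^+ 2).

(* V is a vector field along the curve x *)
Definition nabla_along (x : R -> pt) (V : R -> 'rV[R]_n) : R -> 'rV[R]_n :=
  fun s => derive1 V s + christoffel_term (x s) (derive1 x s) (V s).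

(* nabla_T^j T, with T = x' *)
Definition nablaT (x : R -> pt) (j : nat) : R -> 'rV[R]_n :=
  iter j (nabla_along x) (derive1 x).

Definition tau (r : nat) (x : R -> pt) (s : R) : 'rV[R]_n :=
  nablaT x (2 * r - 1) s +
  \sum_(0 <= l < r.-1)
    (-1) ^+ l *: curvature (x s) (nablaT x (2 * r - 3 - l) s) (nablaT x l s)
                                 (nablaT x 0 s).

(* The two properties characterizing the Levi-Civita connection: no torsion,
   and compatibility with the metric *)

Lemma dg_sym (x : pt) : (\forall y \near x, (g y)^T = g y) ->
  forall k i j, dg k i j x = dg k j i x.
Proof.
move=> gC k i j; apply: near_eq_derive.
by apply: filterS gC => y gyC; rewrite -[in LHS]gyC mxE.
Qed.

Lemma christoffelC (x : pt) : (\forall y \near x, (g y)^T = g y) ->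
  forall k i j, christoffel x k i j = christoffel x k j i.
Proof.
move=> gC k i j; congr (_ * _); apply: eq_bigr => l _.
by rewrite (dg_sym gC l i j) [dg i j l x + _]addrC.
Qed.

Lemma christoffel_metric (x : pt) : (\forall y \near x, (g y)^T = g y) ->
  g x \in unitmx ->
  forall k i j, dg k i j x =
    \sum_(l < n) (christoffel x l k i * g x l j + christoffel x l k j * g x l i).
Proof.
move=> gC gU k i j.
have low a b m : \sum_(l < n) christoffel x l a b * g x l m =
    2^-1 * (dg a b m x + dg b a m x - dg m a b x).
  have gxC : (g x)^T = g x by exact: nbhs_singleton gC.
  have iC : (invmx (g x))^T = invmx (g x) by rewrite trmx_inv gxC.
  transitivity (\sum_(l < n) \sum_(p < n) 2^-1 *
      ((dg a b p x + dg b a p x - dg p a b x) * (invmx (g x) p l * g x l m))).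
    apply: eq_bigr => l _; rewrite /christoffel -mulrA mulr_suml mulr_sumr.
    apply: eq_bigr => p _.
    have -> : invmx (g x) l p = invmx (g x) p l by rewrite -[in LHS]iC mxE.
    by ring.
  rewrite exchange_big /= (bigD1 m) //= [X in _ + X]big1 => [|p pm].
    rewrite addr0 -mulr_sumr -mulr_sumr.
    have := mulVmx gU => /matrixP/(_ m m); rewrite !mxE eqxx /= => ->.
    by rewrite mulr1.
  rewrite -mulr_sumr -mulr_sumr.
  have := mulVmx gU => /matrixP/(_ p m); rewrite !mxE (negbTE pm) /= => ->.
  by rewrite !mulr0.
rewrite big_split /= !low (dg_sym gC k j i) (dg_sym gC i k j) (dg_sym gC j k i).
by field.
Qed.

End LocalGeometry.

(* An atlas with, in each chart, the matrix of components of a metric tensor.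
   The underlying set of the manifold is the union of the chart domains; the
   charts take values in R^n and [point a] is the inverse of [coord a]. *)
Record metric_atlas (R : realType) (n : nat) (M : topologicalType) :=
  MetricAtlas {
    chart : Type ;
    dom : chart -> set M ;
    coord : chart -> M -> 'rV[R]_n ;
    point : chart -> 'rV[R]_n -> M ;
    gcoef : chart -> 'rV[R]_n -> 'M[R]_n }.

Section Manifolds.
Variables (R : realType) (n : nat) (M : topologicalType).
Variable S : metric_atlas R n M.

Definition transition (a b : chart S) : 'rV[R]_n -> 'rV[R]_n :=
  fun x => coord b (point a x).

Definition smooth_manifold : Prop :=
  [/\ hausdorff_space M, @second_countable M,
   forall a : chart S,
     [/\ open (dom a), open (coord a @` dom a),
         (forall p, dom a p -> point a (coord a p) = p),
         (forall p, dom a p -> {for p, continuous (coord a)}) &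
         (forall x, (coord a @` dom a) x -> {for x, continuous (point a)})] &
   forall a b : chart S,
     smooth_on (coord a @` (dom a `&` dom b)) (transition a b)].

Definition riemannian : Prop :=
  [/\ smooth_manifold,
   forall (a : chart S) i j,
     smooth_on (coord a @` dom a) (fun x => gcoef a x i j),
   forall (a : chart S) x, (coord a @` dom a) x ->
     (gcoef a x)^T = gcoef a x /\
     (forall u, u != 0 -> 0 < inner (gcoef a) x u u) &
   forall (a b : chart S) x u v, (coord a @` (dom a `&` dom b)) x ->
     inner (gcoef a) x u v =
     inner (gcoef b) (transition a b x)
       ('D_u (transition a b) x) ('D_v (transition a b) x)].

Definition space_form (c : R) : Prop :=
  riemannian /\
  forall (a : chart S) x (u v : 'rV[R]_n), (coord a @` dom a) x ->
    row_free (col_mx u v) -> sectional_curvature (gcoef a) x u v = c.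

Definition smooth_curve (I : set R) (gam : R -> M) : Prop :=
  [/\ forall s, I s -> exists a : chart S, dom a (gam s),
      forall s, I s -> {for s, continuous gam} &
      forall a : chart S,
        smooth1_on (I `&` gam @^-1` dom a) (fun s => coord a (gam s))].

(* nonnull and parametrized by arc length: |<gam', gam'>| = 1 *)
Definition unit_speed (I : set R) (gam : R -> M) : Prop :=
  forall s (a : chart S), I s -> dom a (gam s) ->
    let x := fun t => coord a (gam t) in
    `|inner (gcoef a) (x s) (derive1 x s) (derive1 x s)| = 1.

Definition geodesic (I : set R) (gam : R -> M) : Prop :=
  smooth_curve I gam /\
  forall s (a : chart S), I s -> dom a (gam s) ->
    nablaT (gcoef a) (fun t => coord a (gam t)) 1 s = 0.

Definition r_harmonic (r : nat) (I : set R) (gam : R -> M) : Prop :=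
  [/\ smooth_curve I gam, unit_speed I gam &
      forall s (a : chart S), I s -> dom a (gam s) ->
        tau (gcoef a) r (fun t => coord a (gam t)) s = 0].

Definition proper_r_harmonic (r : nat) (I : set R) (gam : R -> M) : Prop :=
  r_harmonic r I gam /\ ~ geodesic I gam.

End Manifolds.

(* The Robertson-Walker space-time (J x N, -dt^2 + f(t)^2 g), of dimension
   n.+1: the charts are the products of the identity of J by the charts of N,
   with coordinates (t, x_1, ..., x_n). *)
Definition robertson_walker (R : realType) (n : nat) (M : topologicalType)
    (N : metric_atlas R n M) (J : set R) (f : R -> R) :
    metric_atlas R n.+1 (R * M)%type :=
  @MetricAtlas R n.+1 (R * M)%type (chart N)
    (fun a => J `*` dom a)
    (fun a p => row_mx (const_mx p.1 : 'rV[R]_1) (coord a p.2))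
    (fun a (y : 'rV[R]_(1 + n)) => (y 0 0, point a (rsubmx y)))
    (fun a (y : 'rV[R]_(1 + n)) =>
       block_mx ((-1)%:M : 'M[R]_1) 0 0
         (f (y 0 0) ^+ 2 *: gcoef a (rsubmx y))
       : 'M[R]_(1 + n)).

(* Main.v *)
(* Write k = f'(t0)/f(t0) and let d_t be the unit vector field of J. The warped
   Christoffel symbols give, along the slice curve, nabla_T T = k d_t and
   nabla_T d_t = k T, so nabla_T^j T alternates between k^j T (j even) and
   k^j d_t (j odd). Together with R(d_t, T)T = (f''/f)(t0) d_t, every term of
   the curvature sum contributes the same vector and
     tau_r = (k^(2r-1) + (r-1) k^(2r-3) (f''/f)(t0)) d_t
           = k^(2r-3) f(t0)^(-2) (f'(t0)^2 + (r-1) f(t0) f''(t0)) d_t,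
   while the curve is a geodesic exactly when k = 0. *)

Require Import Defs.
From mathcomp Require Import all_boot all_order all_algebra.
From mathcomp Require Import ring zify.
From mathcomp Require Import all_classical all_reals all_analysis.
Import Order.TTheory GRing.Theory Num.Theory numFieldNormedType.Exports.
Local Open Scope ring_scope.
Local Open Scope classical_set_scope.

Set Implicit Arguments.
Unset Strict Implicit.
Unset Printing Implicit Defensive.

(** * Directional derivatives as derivatives along lines *)

Section DirectionalDerivatives.
Context {R : realType}.

(** The difference quotients on both sides are the same function of the increment. Partial
    derivatives in a chart thereby reduce to calculus in one real variable. *)
Lemma is_derive_line (V W : normedModType R) (F : V -> W) x v D :
  is_derive x v F D <-> is_derive 0 (1 : R) (fun h => F (h *: v + x)) D.
Proof.
have E : 'D_v F x = 'D_(1 : R) (fun h : R => F (h *: v + x)) 0.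
  rewrite /derive; set p := fun h => _; set q := fun h => _.
  suff -> : p = q by [].
  by apply/funext => h; rewrite /p /q /= addr0 scale0r add0r [_%:A]mulr1.
split=> -[dF <-]; split; rewrite ?E//.
  by have /derivable1P := dF.
by apply/derivable1P.
Qed.

Lemma is_derive_mxP (V : normedModType R) (m n : nat) (F : V -> 'M[R]_(m, n))
    x v D :
  is_derive x v F D <-> forall i j, is_derive x v (fun y => F y i j) (D i j).
Proof.
split=> [[dF <-] i j|dF].
  by rewrite derive_mx// mxE; split=> //; apply: (derivable_mxP _ _ _).1.
have dF' : derivable F x v by apply/derivable_mxP => i j.
split=> //; rewrite derive_mx//.
by apply/matrixP => i j; rewrite mxE derive_val.
Qed.

(** In one real variable, derivability amounts to differentiability, and the differential is linear
    in the direction. *)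
Lemma is_derive_scale_dir (W : normedModType R) (F : R -> W) (x a : R) D :
  is_derive x 1 F D -> is_derive x a F (a *: D).
Proof.
move=> [/derivable1_diffP dF <-]; split.
  exact: diff_derivable.
by rewrite deriveE// diff1E// derive1E.
Qed.

Lemma is_derive_rescale (W : normedModType R) (F : R -> W) (d s : R) D :
  is_derive (d * s) 1 F D -> is_derive s 1 (fun t => F (d * t)) (d *: D).
Proof.
move=> /(is_derive_scale_dir d)/is_derive_line FD; apply/is_derive_line.
rewrite (_ : (fun h => _) = (fun h => F (h *: d + d * s)))//.
apply/funext => h.
by rewrite mulrDr [_%:A]mulr1 -[h *: d]/(h * d) [h * d]mulrC.
Qed.

Lemma is_derive_affine (F : R -> R) (t a D : R) :
  is_derive t 1 F D -> is_derive 0 (1 : R) (fun h => F (h * a + t)) (a * D).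
Proof. by move=> /(is_derive_scale_dir a)/is_derive_line. Qed.

End DirectionalDerivatives.

(** * Product coordinates, and the warped metric with its first derivatives and inverse *)

Section WarpedMetric.
Context {R : realType} {n : nat}.
Implicit Types (t a b : R) (x u v w : 'rV[R]_n).

(* A point (t, x) of J x N in a product chart, and likewise a tangent vector. *)
Definition tvec t x : 'rV[R]_n.+1 := row_mx (const_mx t : 'rV_1) x.

Lemma tvec0 t x i : tvec t x i 0 = t.
Proof. by rewrite /tvec mxE split1 unlift_none /= mxE. Qed.

Lemma tvecS t x i j : tvec t x i (lift 0 j) = x i j.
Proof. by rewrite /tvec mxE split1 liftK. Qed.

Lemma rsubmx_tvec t x : rsubmx (tvec t x : 'rV_(1 + n)) = x.
Proof. exact: row_mxKr. Qed.

Lemma tvecD t x a u : tvec t x + tvec a u = tvec (t + a) (x + u).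
Proof.
apply/rowP => i; rewrite [LHS]mxE.
by case: (unliftP 0 i) => [j|] ->; rewrite ?tvecS ?tvec0// mxE.
Qed.

Lemma tvecZ b t x : b *: tvec t x = tvec (b * t) (b *: x).
Proof.
apply/rowP => i; rewrite [LHS]mxE.
by case: (unliftP 0 i) => [j|] ->; rewrite ?tvecS ?tvec0// mxE.
Qed.

Lemma tvec00 : tvec 0 0 = 0.
Proof. by rewrite -(scale0r (tvec 0 0)) tvecZ mul0r scale0r. Qed.

Lemma e_0 : e_ R (0 : 'I_n.+1) = tvec 1 0.
Proof.
apply/rowP => i; rewrite mxE /= eq_sym.
by case: (unliftP 0 i) => [j|] ->; rewrite ?tvecS ?tvec0 ?mxE.
Qed.

Lemma e_S (k : 'I_n) : e_ R (lift 0 k) = tvec 0 (e_ R k).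
Proof.
apply/rowP => i; rewrite mxE /=.
by case: (unliftP 0 i) => [j|] ->; rewrite ?tvecS ?tvec0 ?mxE//=.
Qed.

(* The local form -dt^2 + f(t)^2 h of the Robertson-Walker metric. *)
Definition warped (f : R -> R) (h : 'rV[R]_n -> 'M[R]_n) (y : 'rV[R]_n.+1) :
    'M[R]_n.+1 :=
  (block_mx ((-1)%:M : 'M[R]_1) 0 0
    (f (y 0 0) ^+ 2 *: h (rsubmx (y : 'rV_(1 + n)))) : 'M[R]_(1 + n)).

Variables (f : R -> R) (h : 'rV[R]_n -> 'M[R]_n).
Local Notation G := (warped f h).

Lemma warped00 y : G y 0 0 = -1.
Proof.
by rewrite /warped mxE split1 unlift_none /= mxE split1 unlift_none /= mxE eqxx.
Qed.

Lemma warped0S y j : G y 0 (lift 0 j) = 0.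
Proof.
by rewrite /warped mxE split1 unlift_none /= mxE split1 liftK /= mxE.
Qed.

Lemma warpedS0 y i : G y (lift 0 i) 0 = 0.
Proof.
by rewrite /warped mxE split1 liftK /= mxE split1 unlift_none /= mxE.
Qed.

Lemma warpedSS t x i j :
  G (tvec t x) (lift 0 i) (lift 0 j) = f t ^+ 2 * h x i j.
Proof.
rewrite /warped mxE split1 liftK /= mxE split1 liftK /= mxE.
by rewrite rsubmx_tvec tvec0.
Qed.

Lemma inner_warped t x a b u v :
  inner G (tvec t x) (tvec a u) (tvec b v) =
  - (a * b) + f t ^+ 2 * inner h x u v.
Proof.
rewrite /inner /warped tvec0 rsubmx_tvec /tvec.
rewrite (@mul_row_block R 1 1 n 1 n) (@tr_row_mx R 1 1 n).
rewrite (@mul_row_col R 1 1 n 1) mxE.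
rewrite !mulmx0 add0r addr0 -scalemxAr -scalemxAl mxE; congr (_ + _).
  by rewrite mul_mx_scalar scaleN1r big_ord1 !mxE mulNr.
by rewrite mxE.
Qed.

Lemma dg_warped_const (k i j : 'I_n.+1) (b : R) y :
  (forall z, G z i j = b) -> dg G k i j y = 0.
Proof.
by move=> E; rewrite /dg (_ : (fun _ => _) = cst b) ?derive_cst//; apply/funext.
Qed.

Lemma dg_warped00 k y : dg G k 0 0 y = 0.
Proof. exact: dg_warped_const warped00. Qed.

Lemma dg_warped0S k j y : dg G k 0 (lift 0 j) y = 0.
Proof. by apply: dg_warped_const => z; exact: warped0S. Qed.

Lemma dg_warpedS0 k i y : dg G k (lift 0 i) 0 y = 0.
Proof. by apply: dg_warped_const => z; exact: warpedS0. Qed.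

Lemma dg_warped_time t x i j : derivable f t 1 ->
  dg G 0 (lift 0 i) (lift 0 j) (tvec t x) =
  2 * (f t * derive1 f t) * h x i j.
Proof.
move=> df; have fD : is_derive t 1 f (derive1 f t) by split; rewrite ?derive1E.
rewrite /dg; apply: derive_val; apply/is_derive_line.
rewrite e_0 (_ : (fun s => _) = (fun s => (h x i j * f (s * 1 + t) ^+ 2))).
  have := is_derive_affine 1 fD; set F := fun _ => _ => FD.
  (* Written with the operations on functions, the expression is covered by the derivation rules for
     scaling and powers. *)
  have -> : (fun s => h x i j * f (s * 1 + t) ^+ 2) = h x i j \*: (F ^+ 2).
    by apply/funext.
  apply: is_derive_eq; rewrite /F mul0r add0r expr1 -![_ *: _]/(_ * _); ring.
by apply/funext => s; rewrite tvecZ tvecD warpedSS scaler0 add0r mulrC.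
Qed.

Lemma dg_warped_space t x k i j : derivable (fun z => h z i j) x (e_ R k) ->
  dg G (lift 0 k) (lift 0 i) (lift 0 j) (tvec t x) = f t ^+ 2 * dg h k i j x.
Proof.
move=> dh; rewrite /dg; apply: derive_val; apply/is_derive_line.
have /is_derive_line hD := derivableP dh.
rewrite e_S (_ : (fun s => _) =
  f t ^+ 2 \*: (fun s : R => h (s *: e_ R k + x) i j)).
  exact: is_deriveZ.
by apply/funext => s; rewrite tvecZ tvecD warpedSS mulr0 add0r.
Qed.

(** The matrix is block diagonal, so each block is inverted separately; the time block [-1] is its
    own inverse. *)
Lemma invmx_warped t x : f t != 0 -> h x \in unitmx ->
  invmx (G (tvec t x)) =
  (block_mx ((-1)%:M : 'M[R]_1) 0 0 ((f t ^+ 2)^-1 *: invmx (h x))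
    : 'M[R]_(1 + n)).
Proof.
move=> ft hx; rewrite /warped tvec0 rsubmx_tvec.
have fU : f t ^+ 2 \is a GRing.unit by rewrite unitfE expf_neq0.
have hU : f t ^+ 2 *: h x \in unitmx by rewrite unitmxZ.
have mU : ((-1)%:M : 'M[R]_1) \in unitmx.
  by rewrite unitmxE det_scalar unitrX// unitrN1.
rewrite (@invmx_block_diag R 1 n) ?(@block_diag_mx_unit R 1 n) ?mU//.
by rewrite invmxZ// invmx_scalar invrN1.
Qed.

End WarpedMetric.

(** * Christoffel symbols of the warped metric *)

Section WarpedConnection.
Context {R : realType} {n : nat}.
Implicit Types (u v w : 'rV[R]_n).
Variables (f : R -> R) (h : 'rV[R]_n -> 'M[R]_n) (t : R) (x : 'rV[R]_n).
Local Notation G := (warped f h).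
Hypotheses (f_neq0 : f t != 0) (df : derivable f t 1).
Hypotheses (h_sym : (h x)^T = h x) (h_unit : h x \in unitmx).
Hypothesis dh : forall k i j, derivable (fun z => h z i j) x (e_ R k).

Lemma invmx_warped0 (l : 'I_n.+1) : invmx (G (tvec t x)) 0 l = - (l == 0)%:R.
Proof.
rewrite invmx_warped// mxE split1 unlift_none /= mxE split1.
by case: (unliftP 0 l) => [j|] -> /=; rewrite mxE//= ?oppr0.
Qed.

Lemma invmx_warpedS0 k : invmx (G (tvec t x)) (lift 0 k) 0 = 0.
Proof.
by rewrite invmx_warped// mxE split1 liftK /= mxE split1 unlift_none /= mxE.
Qed.

Lemma invmx_warpedSS k l :
  invmx (G (tvec t x)) (lift 0 k) (lift 0 l) = (f t ^+ 2)^-1 * invmx (h x) k l.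
Proof.
by rewrite invmx_warped// mxE split1 liftK /= mxE split1 liftK /= mxE.
Qed.

Local Notation Gam := (christoffel G (tvec t x)).

(** The time row of the inverse metric is [-1] on the diagonal and zero elsewhere, so one term of
    the sum survives, with its sign reversed. *)
Lemma christoffel_warped0 i j :
  Gam 0 i j = - (2^-1 * (dg G i j 0 (tvec t x) + dg G j i 0 (tvec t x)
                         - dg G 0 i j (tvec t x))).
Proof.
rewrite /christoffel big_ord_recl big1 => [|l _].
  by rewrite invmx_warped0 eqxx mulN1r addr0 mulrN.
by rewrite invmx_warped0 /= mulNr mul0r oppr0.
Qed.

Lemma christoffel_warpedS k i j :
  Gam (lift 0 k) i j = 2^-1 * \sum_(l < n) (f t ^+ 2)^-1 * invmx (h x) k l *
    (dg G i j (lift 0 l) (tvec t x) + dg G j i (lift 0 l) (tvec t x)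
     - dg G (lift 0 l) i j (tvec t x)).
Proof.
rewrite /christoffel big_ord_recl invmx_warpedS0 mul0r add0r; congr (_ * _).
by apply: eq_bigr => l _; rewrite invmx_warpedSS.
Qed.

Let warpedE :=
  (@dg_warped00 R n f h, @dg_warped0S R n f h, @dg_warpedS0 R n f h).

Lemma christoffel_warped000 : Gam 0 0 0 = 0.
Proof. by rewrite christoffel_warped0 !warpedE; ring. Qed.

Lemma christoffel_warped00S j : Gam 0 0 (lift 0 j) = 0.
Proof. by rewrite christoffel_warped0 !warpedE; ring. Qed.

Lemma christoffel_warped0S0 i : Gam 0 (lift 0 i) 0 = 0.
Proof. by rewrite christoffel_warped0 !warpedE; ring. Qed.

Lemma christoffel_warped0SS i j :
  Gam 0 (lift 0 i) (lift 0 j) = f t * derive1 f t * h x i j.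
Proof. by rewrite christoffel_warped0 !warpedE dg_warped_time//; field. Qed.

Lemma christoffel_warpedS00 k : Gam (lift 0 k) 0 0 = 0.
Proof.
rewrite christoffel_warpedS big1 ?mulr0// => l _.
by rewrite !warpedE; ring.
Qed.

Lemma sum_invmx k j : \sum_(l < n) invmx (h x) k l * h x l j = (k == j)%:R.
Proof. by have /matrixP/(_ k j) := mulVmx h_unit; rewrite !mxE. Qed.

Lemma christoffel_warpedS0S k j :
  Gam (lift 0 k) 0 (lift 0 j) = derive1 f t / f t * (k == j)%:R.
Proof.
rewrite christoffel_warpedS -sum_invmx !mulr_sumr; apply: eq_bigr => l _.
rewrite !warpedE dg_warped_time//.
(* Symmetry of [h] puts the indices in the order of [sum_invmx], so that the sum contracts to a
   Kronecker delta. *)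
have -> : h x j l = h x l j by rewrite -[in LHS]h_sym mxE.
by field.
Qed.

Lemma christoffel_warpedSS0 k j :
  Gam (lift 0 k) (lift 0 j) 0 = derive1 f t / f t * (k == j)%:R.
Proof.
rewrite -christoffel_warpedS0S !christoffel_warpedS; congr (_ * _).
by apply: eq_bigr => l _; rewrite !warpedE; ring.
Qed.

Lemma christoffel_warpedSSS k i j :
  Gam (lift 0 k) (lift 0 i) (lift 0 j) = christoffel h x k i j.
Proof.
rewrite christoffel_warpedS; congr (_ * _); apply: eq_bigr => l _.
by rewrite !dg_warped_space//; field.
Qed.

(** All the symbols assembled: the time component is the second-fundamental-form term of the slice,
    the mixed symbols give the factor [f' / f], and the purely spatial symbols are those of [h]. *)
Lemma christoffel_term_warped a b u v :
  christoffel_term G (tvec t x) (tvec a u) (tvec b v) =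
  tvec (f t * derive1 f t * inner h x u v)
       ((derive1 f t / f t) *: (a *: v + b *: u) + christoffel_term h x u v).
Proof.
apply/rowP => k; rewrite mxE.
case: (unliftP 0 k) => [j|] ->; rewrite ?tvecS ?tvec0.
- rewrite big_ord_recl big_ord_recl.
  under [X in _ + X = _]eq_bigr do rewrite big_ord_recl.
  rewrite christoffel_warpedS00 !tvec0 !mul0r add0r big_split /=.
  rewrite !mxE mulrDr addrA; congr (_ + _ + _).
  + rewrite (bigD1 j)//= big1 => [|i ij].
      by rewrite christoffel_warpedS0S eqxx mulr1 tvecS ?tvec0; ring.
    by rewrite christoffel_warpedS0S eq_sym (negbTE ij) mulr0 !mul0r.
  + rewrite (bigD1 j)//= big1 => [|i ij].
      by rewrite christoffel_warpedSS0 eqxx mulr1 tvecS ?tvec0; ring.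
    by rewrite christoffel_warpedSS0 eq_sym (negbTE ij) mulr0 !mul0r.
  + apply: eq_bigr => i _; apply: eq_bigr => l _.
    by rewrite christoffel_warpedSSS !tvecS.
- rewrite big_ord_recl big1 => [|i _]; last first.
    case: (unliftP 0 i) => [l|] ->.
      by rewrite christoffel_warped00S !mul0r.
    by rewrite christoffel_warped000 !mul0r.
  rewrite add0r /inner mxE.
  under [in RHS]eq_bigr do rewrite mxE mulr_suml.
  rewrite [in RHS]exchange_big /= mulr_sumr; apply: eq_bigr => i _.
  rewrite big_ord_recl christoffel_warped0S0 !mul0r add0r mulr_sumr.
  by apply: eq_bigr => l _; rewrite christoffel_warped0SS !tvecS mxE; ring.
Qed.

End WarpedConnection.

Lemma is_derive_tvec (R : realType) n (V : normedModType R) (T : V -> R)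
    (X : V -> 'rV[R]_n) y v DT DX :
  is_derive y v T DT -> is_derive y v X DX ->
  is_derive y v (fun z => tvec (T z) (X z)) (tvec DT DX).
Proof.
move=> TD /is_derive_mxP XD; apply/is_derive_mxP => i k.
case: (unliftP 0 k) => [j|] ->.
  by under eq_fun do rewrite tvecS; rewrite tvecS.
by under eq_fun do rewrite tvec0; rewrite tvec0.
Qed.

(** Formulas known only on an open set may thus be substituted under a derivative along a line
    through one of its points. *)
Lemma near_line (R : realType) (V : normedModType R) (A : set V) (x v : V) :
  open A -> A x -> \forall s \near (0 : R), A (s *: v + x).
Proof.
move=> oA Ax; have : {for 0, continuous (fun s : R => s *: v + x)}.
  apply: (@continuousD _ _ _ (fun s : R => s *: v) (cst x)).
    exact: scalel_continuous.
  exact: cst_continuous.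
by apply; rewrite scale0r add0r; exact: open_nbhs_nbhs.
Qed.

(** * Connection and curvature on constant fields of a chart *)

Section ConstantFields.
Context {R : realType} {n : nat} (g : 'rV[R]_n -> 'M[R]_n).
Implicit Types (u v w x : 'rV[R]_n).

Lemma inner0l x v : inner g x 0 v = 0.
Proof. by rewrite /inner !mul0mx mxE. Qed.

Lemma inner0r x u : inner g x u 0 = 0.
Proof. by rewrite /inner trmx0 mulmx0 mxE. Qed.

Lemma innerZl x a u v : inner g x (a *: u) v = a * inner g x u v.
Proof. by rewrite /inner -!scalemxAl mxE. Qed.

Lemma innerZr x a u v : inner g x u (a *: v) = a * inner g x u v.
Proof. by rewrite /inner linearZ /= -scalemxAr mxE. Qed.

Lemma christoffel_termZl x a u v :
  christoffel_term g x (a *: u) v = a *: christoffel_term g x u v.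
Proof.
apply/rowP => k; rewrite !mxE mulr_sumr; apply: eq_bigr => i _.
by rewrite mulr_sumr; apply: eq_bigr => j _; rewrite mxE; ring.
Qed.

Lemma christoffel_termZr x a u v :
  christoffel_term g x u (a *: v) = a *: christoffel_term g x u v.
Proof.
apply/rowP => k; rewrite !mxE mulr_sumr; apply: eq_bigr => i _.
by rewrite mulr_sumr; apply: eq_bigr => j _; rewrite mxE; ring.
Qed.

Lemma christoffel_term0l x v : christoffel_term g x 0 v = 0.
Proof. by have := christoffel_termZl x 0 0 v; rewrite !scale0r. Qed.

Lemma christoffel_term0r x u : christoffel_term g x u 0 = 0.
Proof. by have := christoffel_termZr x 0 u 0; rewrite !scale0r. Qed.

Lemma nabla_cst u v :
  nabla g (cst u) (cst v) = fun x => christoffel_term g x u v.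
Proof. by apply/funext => x; rewrite /nabla derive_cst add0r. Qed.

(** Constant fields commute, so the Lie bracket term vanishes, and their covariant derivatives are
    pure Christoffel terms. *)
Lemma curvatureE x u v w :
  curvature g x u v w =
  'D_u (fun y => christoffel_term g y v w) x
    + christoffel_term g x u (christoffel_term g x v w)
  - ('D_v (fun y => christoffel_term g y u w) x
    + christoffel_term g x v (christoffel_term g x u w)).
Proof.
rewrite /curvature /riemann !nabla_cst.
have -> : lie_bracket (cst u) (cst v) = cst 0.
  by apply/funext => y; rewrite /lie_bracket !derive_cst subrr.
by rewrite nabla_cst christoffel_term0l subr0.
Qed.

Lemma curvatureC x u v w : curvature g x u v w = - curvature g x v u w.
Proof. by rewrite !curvatureE opprB. Qed.

End ConstantFields.

(** * Curvature of the warped metric on pairs of a time vector and a space vector *)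

Section WarpedCurvature.
Context {R : realType} {n : nat}.
Implicit Types (x u v w : 'rV[R]_n).
Variables (f : R -> R) (h : 'rV[R]_n -> 'M[R]_n).
Variables (J : set R) (V : set 'rV[R]_n).
Local Notation G := (warped f h).
Hypotheses (openJ : open J) (openV : open V).
Hypothesis f_neq0 : forall t, J t -> f t != 0.
Hypothesis df : forall t, J t -> derivable f t 1.
Hypothesis d2f : forall t, J t -> derivable (derive1 f) t 1.
Hypothesis h_sym : forall x, V x -> (h x)^T = h x.
Hypothesis h_unit : forall x, V x -> h x \in unitmx.
Hypothesis dh : forall x, V x ->
  forall k i j, derivable (fun z => h z i j) x (e_ R k).

Let Gam t x a b u v : J t -> V x ->
  christoffel_term G (tvec t x) (tvec a u) (tvec b v) =
  tvec (f t * derive1 f t * inner h x u v)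
       ((derive1 f t / f t) *: (a *: v + b *: u) + christoffel_term h x u v).
Proof.
by move=> Jt Vx; apply: christoffel_term_warped; auto; exact: dh.
Qed.

(** Differentiating [f * f'] in time gives [f * f'' + f'^2]; the quadratic Christoffel terms remove
    the [f'^2], and their spatial parts cancel each other. *)
Lemma curvature_warped t x p u w : J t -> V x ->
  curvature G (tvec t x) (tvec p 0) (tvec 0 u) (tvec 0 w) =
  tvec (p * f t * derive1n 2 f t * inner h x u w) 0.
Proof.
move=> Jt Vx; rewrite curvatureE.
have ff'D : is_derive t 1 (fun t => f t * derive1 f t)
    (f t * derive1n 2 f t + derive1 f t ^+ 2).
  have fD := derivableP (df Jt); have f'D := derivableP (d2f Jt).
  by apply: is_derive_eq (is_deriveM fD f'D) _; rewrite -!derive1E expr2.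
have -> : 'D_(tvec p 0) (fun y => christoffel_term G y (tvec 0 u) (tvec 0 w))
    (tvec t x) =
    tvec (p * (f t * derive1n 2 f t + derive1 f t ^+ 2) * inner h x u w) 0.
  apply: derive_val; apply/is_derive_line.
  have JE := near_line p openJ Jt.
  apply: (near_eq_is_derive (f := fun s : R =>
    tvec (f (s * p + t) * derive1 f (s * p + t) * inner h x u w)
         (christoffel_term h x u w))).
    near=> s; rewrite tvecZ tvecD scaler0 add0r Gam//; last by near: s.
    by rewrite !scale0r addr0 scaler0 add0r.
  apply: is_derive_tvec.
  have := is_derive_affine p ff'D; set F := fun _ => _ => FD.
  rewrite (_ : (fun s => _) = inner h x u w \*: F).
    by rewrite mulrC; exact: is_deriveZ.
  by apply/funext => s; rewrite /F/= -[RHS]/(_ * _) mulrC.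
(* Along a spatial line [t] is fixed, and with one purely temporal argument the Christoffel term
   depends on [t] alone, hence is constant. *)
have -> : 'D_(tvec 0 u) (fun y => christoffel_term G y (tvec p 0) (tvec 0 w))
    (tvec t x) = 0.
  apply: derive_val; apply/is_derive_line.
  apply: (near_eq_is_derive
    (f := cst (tvec 0 (derive1 f t / f t *: (p *: w))))).
    have VE := near_line u openV Vx.
    near=> s; rewrite tvecZ tvecD mulr0 add0r Gam//; last by near: s.
    by rewrite inner0l christoffel_term0l scale0r !addr0 mulr0.
rewrite !Gam// !inner0l !christoffel_term0l !scale0r !scaler0 !addr0 !add0r.
rewrite !mulr0 scale0r scaler0 !add0r !innerZr !christoffel_termZr.
rewrite -scaleN1r tvecD tvecZ tvecD; congr tvec.
  by have := f_neq0 Jt => ft; field.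
by rewrite scaleN1r add0r subrr.
Unshelve. all: by end_near. Qed.

End WarpedCurvature.

(** * Iterated covariant derivatives and tension of a curve in the slice at [t0] *)

Section SliceCurve.
Context {R : realType} {n : nat}.
Variables (f : R -> R) (h : 'rV[R]_n -> 'M[R]_n).
Variables (J : set R) (V : set 'rV[R]_n).
Local Notation G := (warped f h).
Hypotheses (openJ : open J) (openV : open V).
Hypothesis f_neq0 : forall t, J t -> f t != 0.
Hypothesis df : forall t, J t -> derivable f t 1.
Hypothesis d2f : forall t, J t -> derivable (derive1 f) t 1.
Hypothesis h_sym : forall x, V x -> (h x)^T = h x.
Hypothesis h_unit : forall x, V x -> h x \in unitmx.
Hypothesis dh : forall x, V x ->
  forall k i j, derivable (fun z => h z i j) x (e_ R k).
Variables (U : set R) (x : R -> 'rV[R]_n) (t0 : R).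
Hypotheses (openU : open U) (Jt0 : J t0).
Hypothesis xV : forall s, U s -> V (x s).
Hypothesis dx : forall s, U s -> derivable x s 1.
Hypothesis d2x : forall s, U s -> derivable (derive1 x) s 1.
Hypothesis x_geodesic : forall s, U s -> nablaT h x 1 s = 0.
Hypothesis x_speed : forall s, U s ->
  inner h (x s) (derive1 x s) (derive1 x s) = (f t0 ^+ 2)^-1.

Local Notation y := (fun s => tvec t0 (x s)).
Local Notation kappa := (derive1 f t0 / f t0).

Lemma derive1_slice s : U s -> derive1 y s = tvec 0 (derive1 x s).
Proof.
move=> Us; rewrite !derive1E; apply: derive_val.
exact: (is_derive_tvec (is_derive_cst t0 s 1) (derivableP (dx Us))).
Qed.

(** Induction on [j]. From an odd index, the time field has constant components and only the mixed
    symbols act, giving [kappa] times the velocity. From an even index, the geodesic equation of [x]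
    kills the spatial part and a time component remains. *)
Lemma nablaT_slice j s : U s ->
  nablaT G y j s = if odd j then tvec (kappa ^+ j) 0
                   else tvec 0 (kappa ^+ j *: derive1 x s).
Proof.
elim: j s => [|j IH] s Us; first by rewrite /nablaT /= derive1_slice// scale1r.
have ft := f_neq0 Jt0.
have UE : \forall z \near s, U z by exact: open_nbhs_nbhs.
have Gam a b u v : christoffel_term G (tvec t0 (x s)) (tvec a u) (tvec b v) =
    tvec (f t0 * derive1 f t0 * inner h (x s) u v)
      (kappa *: (a *: v + b *: u) + christoffel_term h (x s) u v).
  have Vx := xV Us.
  by apply: christoffel_term_warped; auto; exact: dh.
rewrite /nablaT iterS -/(nablaT G y j) /nabla_along IH// derive1_slice// /=.
have [oj|ej] := boolP (odd j).
  have -> : derive1 (nablaT G y j) s = 0.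
    rewrite derive1E; apply: derive_val.
    (* The induction hypothesis holds on the open set [U], hence near [s], which is enough to
       differentiate it. *)
    apply: (near_eq_is_derive (f := cst (tvec (kappa ^+ j) 0))).
    by near=> z; rewrite IH ?oj//; near: z.
  rewrite Gam add0r inner0r mulr0 scale0r add0r christoffel_term0r addr0.
  by rewrite scalerA -exprS.
have -> : derive1 (nablaT G y j) s =
    tvec 0 (kappa ^+ j *: derive1 (derive1 x) s).
  rewrite derive1E; apply: derive_val.
  apply: (near_eq_is_derive
      (f := fun z => tvec 0 (kappa ^+ j *: derive1 x z))).
    by near=> z; rewrite IH ?(negbTE ej)//; near: z.
  apply: is_derive_tvec; rewrite [derive1 _ s]derive1E.
  by apply: is_deriveZ; exact: derivableP (d2x Us).
rewrite Gam tvecD !scale0r addr0 scaler0 !add0r christoffel_termZr -scalerDr.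
have := x_geodesic Us; rewrite /nablaT /= /nabla_along => ->; rewrite scaler0.
(* The squared spatial speed [(f t0 ^+ 2)^-1] turns the factor [f * f'] into [kappa]. *)
by congr tvec; rewrite innerZr x_speed// [in RHS]exprS; field.
Unshelve. all: by end_near. Qed.

(** The indices [2 * r - 3 - l] and [l] have opposite parity, so each curvature term pairs a time
    vector with a space vector, and the powers of [kappa] multiply to one independent of [l]. All
    [r - 1] terms are therefore equal. *)
Lemma tau_slice r s : (2 <= r)%N -> U s ->
  tau G r y s = tvec (kappa ^+ (2 * r - 1) +
    (r - 1)%:R * kappa ^+ (2 * r - 3) * (derive1n 2 f t0 / f t0)) 0.
Proof.
move=> r2 Us; rewrite /tau nablaT_slice//.
have -> : odd (2 * r - 1) by lia.
have ft := f_neq0 Jt0; have Vx := xV Us.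
set c := kappa ^+ (2 * r - 3) * (derive1n 2 f t0 / f t0).
have curvE p q : curvature G (tvec t0 (x s)) (tvec p 0)
    (tvec 0 (q *: derive1 x s)) (tvec 0 (derive1 x s)) =
    tvec (p * q * (derive1n 2 f t0 / f t0)) 0.
  rewrite (curvature_warped openJ openV f_neq0 df d2f h_sym h_unit dh)//.
  by congr tvec; rewrite innerZl x_speed//; field.
rewrite (eq_big_nat _ _ (F2 := fun=> tvec c 0)) => [|l /andP[_ lr]].
  rewrite sumr_const_nat subn0 -scaler_nat tvecZ scaler0 tvecD addr0.
  by rewrite /c -subn1 -[in RHS]mulrA.
have cE : kappa ^+ (2 * r - 3 - l) * kappa ^+ l = kappa ^+ (2 * r - 3).
  by rewrite -exprD; congr (_ ^+ _); lia.
rewrite !nablaT_slice//=.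
have -> : odd (2 * r - 3 - l) = ~~ odd l by lia.
(* For odd [l] the time vector is the second argument; antisymmetry of the curvature compensates the
   sign [(-1) ^+ l]. *)
rewrite expr0 scale1r -signr_odd; case: (odd l) => /=.
  by rewrite expr1 scaleN1r curvatureC opprK curvE [X in X * _]mulrC cE.
by rewrite expr0 scale1r curvE cE.
Qed.

End SliceCurve.

(** * Positive definite matrices, and smoothness under rescaling and embedding in a slice *)

Lemma posdef_unitmx (R : realFieldType) n (A : 'M[R]_n) :
  (forall u : 'rV_n, u != 0 -> 0 < (u *m A *m u^T) 0 0) -> A \in unitmx.
Proof.
(* A nonzero row in the kernel would have squared norm zero. *)
move=> A0; rewrite -row_free_unit -kermx_eq0; apply/eqP/eqP/rowV0P => u.
move=> /sub_kermxP uA; apply/eqP; apply: contraT => /A0.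
by rewrite uA mul0mx mxE ltxx.
Qed.

(** The chain rule iterated: each differentiation brings out one more factor [d]. *)
Lemma derive1n_rescale (R : realType) (W : normedModType R) (U : set R)
    (z : R -> W) (d : R) k s :
  open [set s | U (d * s)] -> smooth1_on U z -> U (d * s) ->
  is_derive s 1 (derive1n k (fun s => z (d * s)))
    (d ^+ k.+1 *: derive1n k.+1 z (d * s)).
Proof.
move=> oU zU; elim: k s => [|k IH] s Us.
  apply: is_derive_rescale; rewrite derive1nS derive1E.
  exact/derivableP/(zU 0).
apply: (near_eq_is_derive
    (f := fun s => d ^+ k.+1 *: derive1n k.+1 z (d * s))).
  have UE : \forall t \near s, U (d * t).
    by apply: (open_nbhs_nbhs (A := [set s | U (d * s)])).
  near=> t; rewrite [in RHS]derive1nS derive1E; apply/esym/derive_val/IH.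
  by near: t.
rewrite [d ^+ k.+2]exprSr -scalerA; apply: is_deriveZ.
apply: is_derive_rescale; rewrite [in X in is_derive _ _ _ X]derive1nS derive1E.
exact/derivableP/zU.
Unshelve. all: by end_near. Qed.

Lemma smooth1_on_slice (R : realType) n (U : set R) (x : R -> 'rV[R]_n)
    (t0 : R) :
  open U -> smooth1_on U x -> smooth1_on U (fun s => tvec t0 (x s)).
Proof.
move=> oU xU.
(* The time component is [t0] at order zero only; every later derivative of this constant is
   zero. *)
suff E k s : U s -> derive1n k (fun s => tvec t0 (x s)) s =
    tvec (if k is 0 then t0 else 0) (derive1n k x s).
  move=> k s Us; apply: (near_eq_derivable
    (f := fun s => tvec (if k is 0 then t0 else 0) (derive1n k x s))).
    have UE : \forall t \near s, U t by exact: open_nbhs_nbhs.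
    by near=> t; rewrite E//; near: t.
  have := is_derive_tvec (is_derive_cst (if k is 0 then t0 else 0) s 1)
    (derivableP (xU k s Us)).
  by move/@ex_derive.
elim: k s => // k IH s Us; rewrite derive1nS derive1E; apply: derive_val.
apply: (near_eq_is_derive
    (f := fun s => tvec (if k is 0 then t0 else 0) (derive1n k x s))).
  have UE : \forall t \near s, U t by exact: open_nbhs_nbhs.
  by near=> t; rewrite IH//; near: t.
apply: is_derive_tvec.
by rewrite derive1nS derive1E; exact/derivableP/xU.
Unshelve. all: by end_near. Qed.

(** * The slice curve in the charts of the Robertson-Walker space-time *)

Section RobertsonWalkerSlice.
Context {R : realType} {n : nat} {M : topologicalType}.
Variables (N : metric_atlas R n M) (J : set R) (f : R -> R).
Hypothesis hN : riemannian N.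
Hypotheses (openJ : open J) (f_smooth : smooth1_on J f).
Hypothesis f_gt0 : forall t, J t -> 0 < f t.
Variables (I : set R) (alpha : R -> M) (t0 : R).
Hypotheses (openI : open I) (alpha_geod : geodesic N I alpha).
Hypotheses (alpha_unit : unit_speed N I alpha) (Jt0 : J t0).

Local Notation RW := (robertson_walker N J f).
Local Notation d := ((f t0)^-1).
Local Notation Id := [set s | I (d * s)].
Local Notation gam := (fun s => (t0, alpha (d * s))).
Local Notation kappa := (derive1 f t0 / f t0).

Section Chart.
Variable a : chart N.
Local Notation h := (gcoef a).
Local Notation V := (Defs.coord a @` dom a).
Local Notation Ua := (I `&` alpha @^-1` dom a).
Local Notation U := [set s | Ua (d * s)].
Local Notation z := (fun s => Defs.coord a (alpha s)).
Local Notation x := (fun s => z (d * s)).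

Lemma open_coord_image : open V.
Proof. by have [[_ _ /(_ a)[]]] := hN. Qed.

Lemma gcoef_sym y : V y -> (h y)^T = h y.
Proof. by move=> Vy; have [_ _ /(_ a y Vy)[ysym _] _] := hN. Qed.

Lemma gcoef_posdef y u : V y -> u != 0 -> 0 < inner h y u u.
Proof. by move=> Vy; have [_ _ /(_ a y Vy)[_ ypos] _] := hN; exact: ypos. Qed.

Lemma gcoef_unit y : V y -> h y \in unitmx.
Proof. by move=> Vy; apply: posdef_unitmx => u; exact: gcoef_posdef. Qed.

Lemma derivable_gcoef y : V y ->
  forall k i j, derivable (fun w => h w i j) y (e_ R k).
Proof.
move=> Vy k i j; have [_ /(_ a i j 1%N)[_ /(_ k)[dh _]] _ _] := hN.
exact: dh.
Qed.

(** Continuity of [alpha] gives openness; identities valid inside one chart can then be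
    differentiated in the parameter. *)
Lemma open_chart_times : open U.
Proof.
have [[_ alpha_cont _] _] := alpha_geod.
have oUa : open Ua.
  rewrite openE => s [Is as_]; apply: filterI; first exact: open_nbhs_nbhs.
  apply: alpha_cont => //; apply: open_nbhs_nbhs; split=> //.
  by have [[_ _ /(_ a)[]]] := hN.
by apply: (@open_comp _ _ ( *%R d)) => // s _; exact: mulrl_continuous.
Qed.

Let z_smooth : smooth1_on Ua z.
Proof. by have [[_ _]] := alpha_geod. Qed.

Lemma derive_rescaled_curve k s : U s ->
  is_derive s 1 (derive1n k x) (d ^+ k.+1 *: derive1n k.+1 z (d * s)).
Proof.
by move=> Us; apply: derive1n_rescale Us => //; exact: open_chart_times.
Qed.

Lemma rescaled_curve_smooth : smooth1_on U x.
Proof. by move=> k s Us; have [] := derive_rescaled_curve k Us. Qed.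

Lemma derive1_rescaled_curve s : U s -> derive1 x s = d *: derive1 z (d * s).
Proof.
move=> Us; rewrite derive1E; apply: derive_val.
exact: (derive_rescaled_curve 0).
Qed.

(** Rescaling the parameter by [d] multiplies both terms of the acceleration by [d ^+ 2]. *)
Lemma rescaled_curve_geodesic s : U s -> nablaT h x 1 s = 0.
Proof.
move=> Us; rewrite /nablaT /= /nabla_along.
have -> : derive1 (derive1 x) s = d ^+ 2 *: derive1 (derive1 z) (d * s).
  by rewrite derive1E; apply: derive_val; exact: (derive_rescaled_curve 1).
rewrite derive1_rescaled_curve// christoffel_termZl christoffel_termZr scalerA.
rewrite -expr2 -scalerDr; have [_ /(_ (d * s) a Us.1 Us.2)] := alpha_geod.
by rewrite /nablaT /= /nabla_along => ->; rewrite scaler0.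
Qed.

Lemma rescaled_curve_speed s : U s ->
  inner h (x s) (derive1 x s) (derive1 x s) = (f t0 ^+ 2)^-1.
Proof.
move=> Us; rewrite derive1_rescaled_curve// innerZl innerZr mulrA -expr2.
have Vz : V (z (d * s)) by exists (alpha (d * s)) => //; exact: Us.2.
have := alpha_unit Us.1 Us.2; cbv zeta.
(* Unit speed bounds an absolute value; it excludes zero velocity, and for nonzero velocity positive
   definiteness removes the absolute value. *)
have [->|z0] := eqVneq (derive1 z (d * s)) 0.
  by rewrite inner0l normr0 => /esym/eqP; rewrite oner_eq0.
by rewrite gtr0_norm ?gcoef_posdef// => ->; rewrite mulr1 exprVn.
Qed.

Let f_neq0 t : J t -> f t != 0.
Proof. by move=> /f_gt0/gt_eqF ->. Qed.

Let xV s : U s -> V (x s).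
Proof. by move=> [_ as_]; exists (alpha (d * s)). Qed.

Local Notation rwx := (fun s => Defs.coord (a : chart RW) (gam s)).

Lemma nablaT_rw j s : I (d * s) -> dom a (alpha (d * s)) ->
  nablaT (gcoef (a : chart RW)) rwx j s =
  if odd j then tvec (kappa ^+ j) 0
  else tvec 0 (kappa ^+ j *: derive1 x s).
Proof.
move=> Is as_; have Us : U s by [].
(* In a product chart the metric and the coordinates of the curve are [warped] and [tvec] by
   conversion. *)
rewrite -[LHS]/(nablaT (warped f h) (fun s => tvec t0 (x s)) j s).
exact: (nablaT_slice f_neq0 (@f_smooth 0) gcoef_sym gcoef_unit derivable_gcoef
  open_chart_times Jt0 xV (@rescaled_curve_smooth 0) (@rescaled_curve_smooth 1)
  rescaled_curve_geodesic rescaled_curve_speed j Us).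
Qed.

Lemma tau_rw r s : (2 <= r)%N -> I (d * s) -> dom a (alpha (d * s)) ->
  tau (gcoef (a : chart RW)) r rwx s =
  tvec (kappa ^+ (2 * r - 1) +
    (r - 1)%:R * kappa ^+ (2 * r - 3) * (derive1n 2 f t0 / f t0)) 0.
Proof.
move=> r2 Is as_; have Us : U s by [].
rewrite -[LHS]/(tau (warped f h) r (fun s => tvec t0 (x s)) s).
exact: (tau_slice openJ open_coord_image f_neq0 (@f_smooth 0) (@f_smooth 1)
  gcoef_sym gcoef_unit derivable_gcoef
  open_chart_times Jt0 xV (@rescaled_curve_smooth 0) (@rescaled_curve_smooth 1)
  rescaled_curve_geodesic rescaled_curve_speed r2 Us).
Qed.

Lemma unit_speed_rw s : I (d * s) -> dom a (alpha (d * s)) ->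
  inner (gcoef (a : chart RW)) (rwx s) (derive1 rwx s) (derive1 rwx s) = 1.
Proof.
move=> Is as_; have Us : U s by [].
have -> : derive1 rwx s = tvec 0 (derive1 x s).
  exact: (derive1_slice t0 (@rescaled_curve_smooth 0) Us).
rewrite -[LHS]/(inner (warped f h) (tvec t0 (x s)) _ _) inner_warped.
rewrite rescaled_curve_speed// mul0r oppr0 add0r divff//.
by rewrite expf_neq0// f_neq0.
Qed.

Lemma smooth_rw : smooth1_on (Id `&` gam @^-1` (J `*` dom a)) rwx.
Proof.
move=> k s [Is [_ as_]].
have Us : U s by [].
have : smooth1_on U (fun s => tvec t0 (x s)).
  apply: smooth1_on_slice; first exact: open_chart_times.
  exact: rescaled_curve_smooth.
exact.
Qed.

End Chart.

Lemma smooth_curve_rw : smooth_curve RW Id gam.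
Proof.
have [[alpha_chart alpha_cont _] _] := alpha_geod; split.
- by move=> s /alpha_chart[a as_]; exists a.
- move=> s Is; have ac : {for s, continuous (fun t => alpha (d * t))}.
    apply: (@continuous_comp _ _ _ ( *%R d) alpha).
      exact: mulrl_continuous.
    exact: alpha_cont.
  exact: (cvg_pair (cvg_cst t0) ac).
- exact: smooth_rw.
Qed.

(** The acceleration is the constant time vector [kappa], so a single parameter value, available
    since [I] is nonempty, decides the question. *)
Lemma geodesic_rw : I !=set0 -> geodesic RW Id gam <-> derive1 f t0 = 0.
Proof.
have ft0 : f t0 != 0 by rewrite gt_eqF// f_gt0.
move=> [s Is]; split=> [[_ geod]|f'0].
  (* The parameter [f t0 * s] of the slice curve corresponds to the parameter [s] of [alpha]. *)
  have IE : I (d * (f t0 * s)) by rewrite mulKf.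
  have [[/(_ _ IE)[a as_] _ _] _] := alpha_geod.
  have /(_ (conj Jt0 as_)) := geod (f t0 * s) a IE.
  rewrite nablaT_rw// => /rowP/(_ 0); rewrite tvec0 mxE expr1 => /eqP.
  by rewrite mulf_eq0 invr_eq0 (negbTE ft0) orbF => /eqP.
split; first exact: smooth_curve_rw.
move=> s' a Is' [_ as_]; rewrite nablaT_rw// f'0 mul0r expr1.
exact: tvec00.
Qed.

Lemma r_harmonic_rw r : (2 <= r)%N -> I !=set0 ->
  r_harmonic RW r Id gam <->
  kappa ^+ (2 * r - 1) +
    (r - 1)%:R * kappa ^+ (2 * r - 3) * (derive1n 2 f t0 / f t0) = 0.
Proof.
have ft0 : f t0 != 0 by rewrite gt_eqF// f_gt0.
move=> r2 [s Is]; split=> [[_ _ harm]|k0].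
  have IE : I (d * (f t0 * s)) by rewrite mulKf.
  have [[/(_ _ IE)[a as_] _ _] _] := alpha_geod.
  have /(_ (conj Jt0 as_)) := harm (f t0 * s) a IE.
  by rewrite tau_rw// => /rowP/(_ 0); rewrite tvec0 mxE.
split; first exact: smooth_curve_rw.
- move=> s' a Is' [_ as_] w.
  by have := unit_speed_rw Is' as_; rewrite -/w => ->; rewrite normr1.
- by move=> s' a Is' [_ as_]; rewrite tau_rw// k0 tvec00.
Qed.

End RobertsonWalkerSlice.

(** * Factorization of the scalar equation and the final equivalence *)

Theorem theorem1p28 (R : realType) (n : nat) (M : topologicalType)
    (N : metric_atlas R n M) (c : R) (hN : space_form N c)
    (J : set R) (hJ : open_interval J)
    (f : R -> R) (f_smooth : smooth1_on J f) (f_gt0 : forall t, J t -> 0 < f t)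
    (I : set R) (hI : open_interval I)
    (alpha : R -> M) (alpha_geod : geodesic N I alpha)
    (alpha_unit : unit_speed N I alpha)
    (t0 : R) (ht0 : J t0) (d : R) (hd : d = 1 / f t0)
    (r : nat) (hr : (2 <= r)%N) :
  proper_r_harmonic (robertson_walker N J f) r
    [set s | I (d * s)] (fun s => (t0, alpha (d * s)))
  <->
  derive1 f t0 != 0 /\
  derive1 f t0 ^+ 2 + (r - 1)%:R * f t0 * derive1n 2 f t0 = 0.
Proof.
have [rN _] := hN; have [oJ _ _] := hJ; have [oI _ I0] := hI.
have ft0 : f t0 != 0 by rewrite gt_eqF// f_gt0.
rewrite {d}hd div1r /proper_r_harmonic.
rewrite (r_harmonic_rw rN oJ f_smooth f_gt0 oI alpha_geod alpha_unit ht0 hr I0).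
rewrite (geodesic_rw rN f_smooth f_gt0 oI alpha_geod alpha_unit ht0 I0).
set b := derive1 f t0; set b2 := derive1n 2 f t0.
(* The common factor [kappa ^+ (2 * r - 3)] comes out; as [r] is at least 2, the truncated
   subtractions are exact. *)
have -> : (b / f t0) ^+ (2 * r - 1) +
    (r - 1)%:R * (b / f t0) ^+ (2 * r - 3) * (b2 / f t0) =
    (b / f t0) ^+ (2 * r - 3) / f t0 ^+ 2 *
    (b ^+ 2 + (r - 1)%:R * f t0 * b2).
  have -> : (2 * r - 1 = 2 * r - 3 + 2)%N by lia.
  by rewrite exprD; field.
split=> [[/eqP + /eqP b0]|[b0 ->]]; last first.
  by rewrite mulr0; split=> //; exact/eqP.
(* Since the curve is not a geodesic, [b] is nonzero, so the prefactor cannot vanish. *)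
rewrite !mulf_eq0 expf_eq0 invr_eq0 expf_eq0 mulf_eq0 invr_eq0.
by rewrite (negbTE b0) (negbTE ft0) !andbF /= => /eqP.
Qed.
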